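(* Let $f$ be a smooth real function and let $R_1(u,v)=(u\cosh v,\,u\sinh v,\,f(u))$ be the rotational surface with space-like meridians in the pseudo-isotropic space $\mathbb{I}_p^3$. Let $\theta\in\mathbb{R}^+$. Then the space-like loxodromes on $R_1$ (with constant pseudo-isotropic angle $\theta$ to the meridians) are the curves $$\gamma_1(t)=\bigl(\pm t\cosh\theta\,\cosh(\pm\tanh\theta\,\ln|t|),\ \pm t\cosh\theta\,\sinh(\pm\tanh\theta\,\ln|t|),\ f(\pm t\cosh\theta)\bigr),$$ that is, $\gamma_1(t)=R_1(u(t),v(t))$ with $u(t)=\varepsilon_1 t\cosh\theta$ and $v(t)=\varepsilon_2\tanh\theta\,\ln|t|$, where $\varepsilon_1,\varepsilon_2\in\{1,-1\}$.
   Context: Pseudo-isotropic space $\mathbb{I}_p^3$ is $\mathbb{R}^3$ with coordinates $(x,y,z)$ and the pseudo-isotropic scalar product, for $p=(p_1,p_2,p_3)$ and $q=(q_1,q_2,q_3)$: $\langle p,q\rangle=p_3q_3$ if $p_1=p_2=0$ and $q_1=q_2=0$, and $\langle p,q\rangle=p_1q_1-p_2q_2$ otherwise. A vector $(0,0,p_3)$ is called isotropic; other vectors are non-isotropic. A non-isotropic vector $p$ is space-like if $\langle p,p\rangle>0$, time-like if $\langle p,p\rangle<0$, light-like if $\langle p,p\rangle=0$; a curve is space-like (time-like) if its velocity vectors are. Put $\|p\|=\sqrt{|\langle p,p\rangle|}$. The surface $R_1(u,v)=(u\cosh v,u\sinh v,f(u))$ is obtained by applying the hyperbolic rotations $(x,y,z)\mapsto(x\cosh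 v+y\sinh v,\ x\sinh v+y\cosh v,\ z)$, $v\in\mathbb{R}$, to the space-like profile curve $\alpha_1(u)=(u,0,f(u))$. Its induced metric is $ds^2=du^2-u^2dv^2$. Its meridians are the curves $\beta_v(u)=R_1(u,v)$ with $v$ constant; they are space-like. The pseudo-isotropic angle $\theta\in\mathbb{R}^+$ between two space-like non-isotropic vectors $p,q$ spanning a time-like vector subspace is given by $|\langle p,q\rangle|=\|p\|\,\|q\|\cosh\theta$. A loxodrome is a curve on the rotational surface which cuts all meridians at a constant angle, i.e. the angle between its velocity vector at each of its points and the meridian's tangent vector $\beta_v'$ at that point is constant.
   Formalization: The converse holds only up to integration constants (adding a constant v0 to v gives other loxodromes): each smooth space-like loxodrome on an open interval is shown to be a hyperbolic rotation of some γ₁ taken at an arc-length parameter; each γ₁ is a loxodrome on intervals avoiding t=0. *)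

(* Defs.v *)
From Stdlib Require Import Reals.
From Coquelicot Require Import Coquelicot.
Open Scope R_scope.

Definition vec3 : Type := (R * R * R)%type.

Definition crd1 (p : vec3) : R := fst (fst p).
Definition crd2 (p : vec3) : R := snd (fst p).
Definition crd3 (p : vec3) : R := snd p.

Definition isotropic (p : vec3) : Prop := crd1 p = 0 /\ crd2 p = 0.

Definition isotropic_dec (p : vec3) : {isotropic p} + {~ isotropic p}.
Proof.
  unfold isotropic.
  destruct (Req_EM_T (crd1 p) 0) as [h1 | h1];
    [ destruct (Req_EM_T (crd2 p) 0) as [h2 | h2] | ]; [left | right | right]; tauto.
Defined.

(* Because of the case distinction this is not bilinear on R^3; it is
   bilinear on every subspace containing no nonzero isotropic vector. *)
Definition sprod (p q : vec3) : R :=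
  if isotropic_dec p then
    if isotropic_dec q then crd3 p * crd3 q
    else crd1 p * crd1 q - crd2 p * crd2 q
  else crd1 p * crd1 q - crd2 p * crd2 q.

Definition space_like (p : vec3) : Prop := ~ isotropic p /\ 0 < sprod p p.
Definition time_like (p : vec3) : Prop := ~ isotropic p /\ sprod p p < 0.

Definition pnorm (p : vec3) : R := sqrt (Rabs (sprod p p)).

Definition span2 (p q : vec3) (w : vec3) : Prop :=
  exists a b : R, w = plus (scal a p) (scal b q).

(* The product is nondegenerate of index 1 on W.  The index is at most 1 on
   every subspace, since x^2 - y^2 has a single negative direction, so that
   index 1 amounts to the presence of a time-like vector. *)
Definition time_like_subspace (W : vec3 -> Prop) : Prop :=
  (forall w, W w -> (forall x, W x -> sprod w x = 0) -> w = zero) /\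
  (exists w, W w /\ time_like w).

Definition is_angle (p q : vec3) (theta : R) : Prop :=
  space_like p /\ space_like q /\ time_like_subspace (span2 p q) /\
  0 < theta /\ Rabs (sprod p q) = pnorm p * pnorm q * cosh theta.

Definition in_interval (a b : Rbar) (t : R) : Prop := Rbar_lt a t /\ Rbar_lt t b.

Definition smooth_on (a b : Rbar) (g : R -> R) : Prop :=
  forall (n : nat) (t : R), in_interval a b t -> ex_derive_n g n t.

Definition smooth (g : R -> R) : Prop := smooth_on m_infty p_infty g.

Definition velocity (c : R -> vec3) (t : R) : vec3 :=
  (Derive (fun s => crd1 (c s)) t,
   Derive (fun s => crd2 (c s)) t,
   Derive (fun s => crd3 (c s)) t).

Definition hyp_rotation (v : R) (p : vec3) : vec3 :=
  (crd1 p * cosh v + crd2 p * sinh v,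
   crd1 p * sinh v + crd2 p * cosh v,
   crd3 p).

Definition profile1 (f : R -> R) (u : R) : vec3 := (u, 0, f u).

Definition R1 (f : R -> R) (u v : R) : vec3 := (u * cosh v, u * sinh v, f u).

Lemma R1_rotation (f : R -> R) (u v : R) :
  R1 f u v = hyp_rotation v (profile1 f u).
Proof.
  unfold R1, hyp_rotation, profile1, crd1, crd2, crd3; simpl.
  rewrite !Rmult_0_l, !Rplus_0_r; reflexivity.
Qed.

Definition meridian (f : R -> R) (v : R) : R -> vec3 := fun u => R1 f u v.

(* The condition u <> 0 (the metric du^2 - u^2 dv^2 degenerates at u = 0) is
   not imposed: it follows from the angle condition, because for u = 0 the
   velocity is proportional to that of the meridian. *)
Definition space_like_loxodrome (f : R -> R) (theta : R) (a b : Rbar)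
    (gamma : R -> vec3) : Prop :=
  exists u v : R -> R,
    smooth_on a b u /\ smooth_on a b v /\
    (forall t, in_interval a b t -> gamma t = R1 f (u t) (v t)) /\
    (forall t, in_interval a b t -> space_like (velocity gamma t)) /\
    (forall t, in_interval a b t ->
       is_angle (velocity gamma t) (velocity (meridian f (v t)) (u t)) theta).

Definition is_sign (e : R) : Prop := e = 1 \/ e = -1.

Definition gamma1 (f : R -> R) (theta e1 e2 t : R) : vec3 :=
  (e1 * t * cosh theta * cosh (e2 * tanh theta * ln (Rabs t)),
   e1 * t * cosh theta * sinh (e2 * tanh theta * ln (Rabs t)),
   f (e1 * t * cosh theta)).

(* When the velocity is never isotropic or light-like, such a phi is a smooth
   change of parameter, unique up to an additive constant; it is a translation
   t + c when gamma has unit speed. *)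
Definition arc_length_parameter (a b : Rbar) (gamma : R -> vec3)
    (phi : R -> R) : Prop :=
  smooth_on a b phi /\
  (forall t, in_interval a b t -> Derive phi t = pnorm (velocity gamma t)).

(* Main.v *)
Require Import Defs.
From Stdlib Require Import Reals Lra Factorial Ranalysis5.
From Coquelicot Require Import Coquelicot.
Open Scope R_scope.

(** In the frame formed by the meridian velocity [q] and the rotation direction
    [n = (sinh v, cosh v, 0)], with squares 1 and -1, the velocity of [R1 f u v]
    is [u' q + u v' n].  The angle condition therefore says
    [u'^2 = (u'^2 - u^2 v'^2) (cosh theta)^2], that is,
    [u v' cosh theta = +- u' sinh theta] with [u' <> 0]; in particular the speed
    is [|u'| / cosh theta], so [u / cosh theta] is an arc length parameter up to
    sign.  As neither [u] nor [u'] nor [v'] vanishes, the sign is constant, and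
    integrating [v' = +- tanh theta u' / u] gives [v] up to a constant, which is
    the angle of a hyperbolic rotation. *)

(** * Hyperbolic functions *)

Lemma cosh_pos (x : R) : 0 < cosh x.
Proof.
  unfold cosh; generalize (exp_pos x) (exp_pos (- x)); lra.
Qed.

Lemma cosh2_sub_sinh2 (x : R) : cosh x * cosh x - sinh x * sinh x = 1.
Proof.
  unfold cosh, sinh.
  assert (h : exp x * exp (- x) = 1) by (rewrite <- exp_plus, Rplus_opp_r; apply exp_0).
  lra.
Qed.

Lemma sinh_pos (x : R) : 0 < x -> 0 < sinh x.
Proof.
  intros hx; unfold sinh.
  assert (exp (- x) < exp x) by (apply exp_increasing; lra); lra.
Qed.

Lemma cosh_plus (x y : R) : cosh (x + y) = cosh x * cosh y + sinh x * sinh y.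
Proof.
  unfold cosh, sinh; rewrite Ropp_plus_distr, !exp_plus; field.
Qed.

Lemma sinh_plus (x y : R) : sinh (x + y) = sinh x * cosh y + cosh x * sinh y.
Proof.
  unfold cosh, sinh; rewrite Ropp_plus_distr, !exp_plus; field.
Qed.

(** * Open intervals with extended real endpoints *)

Lemma in_interval_locally (a b : Rbar) (t : R) :
  in_interval a b t -> locally t (in_interval a b).
Proof.
  intros [h1 h2]; apply filter_and.
  - exact (open_Rbar_gt a t h1).
  - exact (open_Rbar_lt b t h2).
Qed.

Lemma in_interval_inhabited (a b : Rbar) : Rbar_lt a b -> exists t, in_interval a b t.
Proof.
  unfold in_interval; destruct a as [a | |], b as [b | |]; simpl; try tauto; intros h.
  - exists ((a + b) / 2); lra.
  - exists (a + 1); split; [lra | exact I].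
  - exists (b - 1); split; [exact I | lra].
  - exists 0; tauto.
Qed.

Lemma in_interval_convex (a b : Rbar) (s t x : R) :
  in_interval a b s -> in_interval a b t -> s <= x <= t -> in_interval a b x.
Proof.
  intros [h1 _] [_ h2] [h3 h4]; split.
  - exact (Rbar_lt_le_trans a s x h1 h3).
  - exact (Rbar_le_lt_trans x t b h4 h2).
Qed.

(** * Constant sign and constant value on an interval *)

Lemma is_sign_sqr (e : R) : is_sign e -> e * e = 1.
Proof.
  intros [-> | ->]; lra.
Qed.

Lemma is_sign_of_neq0 (x : R) : x <> 0 -> exists e, is_sign e /\ 0 < e * x.
Proof.
  intros hx; destruct (Rlt_le_dec 0 x).
  - exists 1; split; [now left | lra].
  - exists (-1); split; [now right | lra].
Qed.

(** By the intermediate value theorem a change of sign between [s] and [t] would produce a zero.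
    [IVT_interv] wants a negative value at the left end, hence the passage to [- g] when [s < t]. *)
Lemma same_sign_of_neq0 (a b : Rbar) (g : R -> R) (s t : R) :
  (forall x, in_interval a b x -> continuity_pt g x) ->
  (forall x, in_interval a b x -> g x <> 0) ->
  in_interval a b s -> in_interval a b t -> 0 < g s -> 0 < g t.
Proof.
  intros hc hn hs ht hgs.
  destruct (Rlt_le_dec 0 (g t)) as [h | h]; [exact h | exfalso].
  assert (hgt : g t < 0) by (generalize (hn t ht); lra).
  destruct (Rtotal_order s t) as [hst | [<- | hst]]; [ | lra | ].
  - destruct (IVT_interv (fun x => - g x) s t) as [z [hz hz0]]; try lra.
    + intros x hx; apply continuity_pt_opp, hc.
      exact (in_interval_convex a b s t x hs ht hx).
    + apply (hn z); [exact (in_interval_convex a b s t z hs ht hz) | lra].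
  - destruct (IVT_interv g t s) as [z [hz hz0]]; try lra.
    + intros x hx; apply hc.
      exact (in_interval_convex a b t s x ht hs hx).
    + apply (hn z); [exact (in_interval_convex a b t s z ht hs hz) | lra].
Qed.

Lemma constant_sign (a b : Rbar) (g : R -> R) :
  Rbar_lt a b ->
  (forall x, in_interval a b x -> ex_derive g x) ->
  (forall x, in_interval a b x -> g x <> 0) ->
  exists e, is_sign e /\ forall t, in_interval a b t -> 0 < e * g t.
Proof.
  intros hab hd hn.
  destruct (in_interval_inhabited a b hab) as [s hs].
  destruct (is_sign_of_neq0 (g s) (hn s hs)) as [e [he hes]].
  exists e; split; [exact he | intros t ht].
  apply (same_sign_of_neq0 a b (fun x => e * g x) s t); trivial.
  - intros x hx; apply continuity_pt_scal, continuity_pt_filterlim.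
    exact (ex_derive_continuous g x (hd x hx)).
  - intros x hx; apply Rmult_integral_contrapositive_currified; [ | exact (hn x hx)].
    destruct he; lra.
Qed.

Lemma constant_of_is_derive_0 (a b : Rbar) (g : R -> R) (s t : R) :
  (forall x, in_interval a b x -> is_derive g x 0) ->
  in_interval a b s -> in_interval a b t -> g t = g s.
Proof.
  intros hd hs ht.
  assert (hin : forall x, Rmin s t <= x <= Rmax s t -> in_interval a b x).
  { intros x hx; unfold Rmin, Rmax in hx; destruct (Rle_dec s t).
    - exact (in_interval_convex a b s t x hs ht hx).
    - exact (in_interval_convex a b t s x ht hs hx). }
  destruct (MVT_gen g s t (fun _ => 0)) as [c [_ hc]].
  - intros x hx; apply hd, hin; lra.
  - intros x hx; apply continuity_pt_filterlim, (ex_derive_continuous g x).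
    exists 0; apply hd, hin, hx.
  - lra.
Qed.

(** * Smoothness of ln |t| away from 0 *)

Lemma is_derive_ln_Rabs (x : R) : x <> 0 -> is_derive (fun t => ln (Rabs t)) x (/ x).
Proof.
  intros hx; auto_derive.
  - split; [exact hx | split; [now apply Rabs_pos_lt | exact I]].
  - destruct (Rlt_le_dec x 0).
    + rewrite sign_eq_m1, Rabs_left by lra; field; exact hx.
    + rewrite sign_eq_1, Rabs_pos_eq by lra; field; exact hx.
Qed.

(** An explicit formula is carried through the induction, because it can be differentiated once
    more: it holds on the whole open set [t <> 0], hence near [x]. *)
Lemma is_derive_n_ln_Rabs (n : nat) (x : R) :
  x <> 0 ->
  is_derive_n (fun t => ln (Rabs t)) (S n) x ((-1) ^ n * INR (fact n) / x ^ S n).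
Proof.
  revert x; induction n as [| n IH]; intros x hx.
  - apply (is_derive_ext (fun t => ln (Rabs t))); [reflexivity | ].
    replace ((-1) ^ 0 * INR (fact 0) / x ^ 1) with (/ x) by (simpl; field; exact hx).
    now apply is_derive_ln_Rabs.
  - apply (is_derive_ext_loc (fun t => (-1) ^ n * INR (fact n) / t ^ S n)).
    + apply (filter_imp (fun t => t <> 0)); [ | exact (open_neq 0 x hx)].
      intros t ht; symmetry; now apply is_derive_n_unique, IH.
    + assert (hp : x ^ n <> 0) by now apply pow_nonzero.
      auto_derive.
      * apply Rmult_integral_contrapositive_currified; assumption.
      * rewrite fact_simpl, mult_INR, S_INR; simpl.
        destruct n; simpl in *; field; [exact hx | ].
        split; [intros h; apply hp; rewrite h; ring | exact hx].
Qed.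

Lemma ex_derive_n_ln_Rabs (n : nat) (x : R) :
  x <> 0 -> ex_derive_n (fun t => ln (Rabs t)) n x.
Proof.
  intros hx; destruct n as [| n]; [exact I | ].
  eexists; exact (is_derive_n_ln_Rabs n x hx).
Qed.

(** * Velocities of smooth curves on the surface *)

Lemma smooth_on_ex_derive (a b : Rbar) (g : R -> R) (t : R) :
  smooth_on a b g -> in_interval a b t -> ex_derive g t.
Proof.
  intros hg ht; exact (hg 1%nat t ht).
Qed.

Lemma smooth_on_ex_derive_Derive (a b : Rbar) (g : R -> R) (t : R) :
  smooth_on a b g -> in_interval a b t -> ex_derive (Derive g) t.
Proof.
  intros hg ht; exact (hg 2%nat t ht).
Qed.

Lemma smooth_ex_derive (f : R -> R) (x : R) : smooth f -> ex_derive f x.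
Proof.
  intros hf; exact (hf 1%nat x (conj I I)).
Qed.

(** The tangent vector [du q + u dv n] in the frame [q = (cosh v, sinh v, m)],
    [n = (sinh v, cosh v, 0)]. The slope [m] stands for [f' (u)]; keeping it a free number turns the
    metric arguments into algebra. *)
Definition surface_velocity (u v m du dv : R) : vec3 :=
  (du * cosh v + u * dv * sinh v, du * sinh v + u * dv * cosh v, m * du).

(** Chain rule. The parametrization is asked for only near [t], since a loxodrome is known to lie on
    the surface only over its interval. *)
Lemma velocity_R1 (f : R -> R) (gamma : R -> vec3) (u v : R -> R) (t : R) :
  smooth f -> ex_derive u t -> ex_derive v t ->
  locally t (fun s => gamma s = Defs.R1 f (u s) (v s)) ->
  velocity gamma t =
    surface_velocity (u t) (v t) (Derive f (u t)) (Derive u t) (Derive v t).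
Proof.
  intros hf hu hv hg; unfold velocity, surface_velocity.
  assert (hfu := smooth_ex_derive f (u t) hf).
  f_equal; [f_equal | ].
  - rewrite (Derive_ext_loc _ (fun s => u s * cosh (v s))).
    + apply is_derive_unique; auto_derive; [tauto | ].
      change (fun x => u x) with u; change (fun x => v x) with v; ring.
    + revert hg; apply filter_imp; intros s ->; reflexivity.
  - rewrite (Derive_ext_loc _ (fun s => u s * sinh (v s))).
    + apply is_derive_unique; auto_derive; [tauto | ].
      change (fun x => u x) with u; change (fun x => v x) with v; ring.
    + revert hg; apply filter_imp; intros s ->; reflexivity.
  - rewrite (Derive_ext_loc _ (fun s => f (u s))).
    + apply is_derive_unique; auto_derive; [tauto | ].
      change (fun x => f x) with f; change (fun x => u x) with u; ring.
    + revert hg; apply filter_imp; intros s ->; reflexivity.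
Qed.

Lemma velocity_meridian (f : R -> R) (u v : R) :
  smooth f -> velocity (meridian f v) u = surface_velocity u v (Derive f u) 1 0.
Proof.
  intros hf.
  rewrite (velocity_R1 f (meridian f v) (fun s => s) (fun _ => v) u hf).
  - now rewrite Derive_id, Derive_const.
  - apply ex_derive_id.
  - apply ex_derive_const.
  - apply filter_forall; reflexivity.
Qed.

(** * The scalar product of tangent vectors *)

Lemma sprod_non_isotropic_l (p q : vec3) :
  ~ isotropic p -> sprod p q = crd1 p * crd1 q - crd2 p * crd2 q.
Proof.
  intros hp; unfold sprod; destruct (isotropic_dec p); [contradiction | reflexivity].
Qed.

Lemma sprod_non_isotropic_r (p q : vec3) :
  ~ isotropic q -> sprod p q = crd1 p * crd1 q - crd2 p * crd2 q.
Proof.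
  intros hq; unfold sprod.
  destruct (isotropic_dec p), (isotropic_dec q); tauto.
Qed.

Lemma non_isotropic_of_form_neq0 (p : vec3) :
  crd1 p * crd1 p - crd2 p * crd2 p <> 0 -> ~ isotropic p.
Proof.
  intros h [h1 h2]; apply h; rewrite h1, h2; ring.
Qed.

Lemma space_like_iff (p : vec3) :
  space_like p <-> 0 < crd1 p * crd1 p - crd2 p * crd2 p.
Proof.
  split.
  - intros [h1 h2]; now rewrite sprod_non_isotropic_l in h2.
  - intros h.
    assert (h1 : ~ isotropic p) by (apply non_isotropic_of_form_neq0; lra).
    split; [exact h1 | now rewrite sprod_non_isotropic_l].
Qed.

(** This is the induced metric du^2 - u^2 dv^2 in polarized form: the frame vectors are orthogonal,
    with squares 1 and -1. *)
Lemma surface_velocity_form (u v m du dv du' dv' : R) :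
  let p := surface_velocity u v m du dv in
  let q := surface_velocity u v m du' dv' in
  crd1 p * crd1 q - crd2 p * crd2 q = du * du' - u * dv * (u * dv').
Proof.
  intros p q; unfold p, q, crd1, crd2, surface_velocity; simpl.
  transitivity ((cosh v * cosh v - sinh v * sinh v) *
                (du * du' - u * dv * (u * dv'))); [ring | ].
  rewrite cosh2_sub_sinh2; ring.
Qed.

Lemma space_like_meridian (u v m : R) : space_like (surface_velocity u v m 1 0).
Proof.
  apply space_like_iff; rewrite surface_velocity_form; lra.
Qed.

Lemma pnorm_surface_velocity (u v m du dv : R) :
  space_like (surface_velocity u v m du dv) ->
  pnorm (surface_velocity u v m du dv) = sqrt (du * du - u * dv * (u * dv)).
Proof.
  intros h; unfold pnorm; rewrite Rabs_pos_eq by (destruct h; lra).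
  now rewrite sprod_non_isotropic_l, surface_velocity_form by apply h.
Qed.

(** * The tangent plane *)

Lemma vec3_lin_comb (x y : R) (p q : vec3) :
  plus (scal x p) (scal y q) =
    (x * crd1 p + y * crd1 q, x * crd2 p + y * crd2 q, x * crd3 p + y * crd3 q).
Proof.
  reflexivity.
Qed.

(** For [u * dv <> 0] the two velocities are independent, so they span the whole tangent plane,
    described here by coordinates [x], [y] in the frame [q], [n]. *)
Lemma span2_surface_velocity (u v m du dv : R) (w : vec3) :
  u * dv <> 0 ->
  span2 (surface_velocity u v m du dv) (surface_velocity u v m 1 0) w <->
  exists x y, w = (x * cosh v + y * sinh v, x * sinh v + y * cosh v, x * m).
Proof.
  intros hn; split.
  - intros (a & b & ->); exists (a * du + b), (a * (u * dv)).
    rewrite vec3_lin_comb; unfold surface_velocity, crd1, crd2, crd3; simpl.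
    f_equal; [f_equal | ]; ring.
  (* The coefficients solve the triangular system [a * du + b = x], [a * (u * dv) = y]. *)
  - intros (x & y & ->); exists (y / (u * dv)), (x - y / (u * dv) * du).
    assert (u <> 0) by (intros ->; apply hn; ring).
    assert (dv <> 0) by (intros ->; apply hn; ring).
    rewrite vec3_lin_comb; unfold surface_velocity, crd1, crd2, crd3; simpl.
    f_equal; [f_equal | ]; field; auto.
Qed.

(** Pairing [w = x q + y n] with [q] and [n] gives [x] and [- y], whence nondegeneracy; the vector
    [n] is time-like. *)
Lemma time_like_tangent_plane (u v m du dv : R) :
  u * dv <> 0 ->
  time_like_subspace
    (span2 (surface_velocity u v m du dv) (surface_velocity u v m 1 0)).
Proof.
  intros hn; assert (hcs := cosh2_sub_sinh2 v); split.
  - intros w hw hx.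
    set (q := (cosh v, sinh v, m) : vec3).
    set (n := (sinh v, cosh v, 0) : vec3).
    assert (hq : sprod w q = 0).
    { apply hx, span2_surface_velocity; [exact hn | ].
      exists 1, 0; unfold q; f_equal; [f_equal | ]; ring. }
    assert (hn' : sprod w n = 0).
    { apply hx, span2_surface_velocity; [exact hn | ].
      exists 0, 1; unfold n; f_equal; [f_equal | ]; ring. }
    apply span2_surface_velocity in hw; [ | exact hn].
    destruct hw as (x & y & ->).
    (* Since [q] and [n] are non-isotropic, the formula x1 x2 - y1 y2 applies whether or not [w] is
       isotropic. *)
    rewrite sprod_non_isotropic_r in hq, hn'.
    + unfold q, n, crd1, crd2 in *; simpl in *.
      assert (x = x * (cosh v * cosh v - sinh v * sinh v)) by (rewrite hcs; ring).
      assert (y = y * (cosh v * cosh v - sinh v * sinh v)) by (rewrite hcs; ring).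
      assert (hx0 : x = 0) by lra; assert (hy0 : y = 0) by lra.
      rewrite hx0, hy0, !Rmult_0_l, Rplus_0_r; reflexivity.
    + apply non_isotropic_of_form_neq0; unfold n, crd1, crd2; simpl; lra.
    + apply non_isotropic_of_form_neq0; unfold q, crd1, crd2; simpl; lra.
  - set (n := (sinh v, cosh v, 0) : vec3); exists n; split.
    + apply span2_surface_velocity; [exact hn | ].
      exists 0, 1; unfold n; f_equal; [f_equal | ]; ring.
    + assert (hni : ~ isotropic n).
      { apply non_isotropic_of_form_neq0; unfold n, crd1, crd2; simpl; lra. }
      split; [exact hni | rewrite sprod_non_isotropic_l by exact hni].
      unfold n, crd1, crd2; simpl; lra.
Qed.

(** * The angle with the meridians *)

(** Both sides of the angle equation are nonnegative, so squaring it gives an equivalent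
    equation. *)
Lemma sqrt_mult_eq_Rabs_iff (d n c : R) :
  0 < c -> 0 <= d -> (Rabs n = sqrt d * c <-> n * n = d * (c * c)).
Proof.
  intros hc hd; split; intros h.
  - change (Rsqr n = d * (c * c)).
    rewrite (Rsqr_abs n), h, Rsqr_mult, Rsqr_sqrt by exact hd; reflexivity.
  - rewrite <- sqrt_Rsqr_abs; unfold Rsqr; rewrite h.
    rewrite sqrt_mult_alt, sqrt_square by lra; reflexivity.
Qed.

(** The meridian velocity has norm 1 and product [du] with the other vector. Squaring the angle
    equation and substituting cosh^2 = 1 + sinh^2 gives the last clause; conversely, that clause
    with [du <> 0] and [0 < theta] also yields the causal conditions in [is_angle]. *)
Lemma is_angle_surface_velocity_iff (u v m du dv theta : R) :
  is_angle (surface_velocity u v m du dv) (surface_velocity u v m 1 0) theta <->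
  0 < theta /\ du <> 0 /\
  u * dv * cosh theta * (u * dv * cosh theta) = du * sinh theta * (du * sinh theta).
Proof.
  assert (hc := cosh_pos theta); assert (hcs := cosh2_sub_sinh2 theta).
  assert (hq := space_like_meridian u v m).
  assert (hqn : pnorm (surface_velocity u v m 1 0) = 1).
  { rewrite pnorm_surface_velocity by exact hq.
    transitivity (sqrt 1); [f_equal; ring | apply sqrt_1]. }
  assert (hcs' : forall x, x * x * (cosh theta * cosh theta) =
                           x * x + x * sinh theta * (x * sinh theta)).
  { intros x; replace (cosh theta * cosh theta)
      with (1 + sinh theta * sinh theta) by lra; ring. }
  assert (hpq : space_like (surface_velocity u v m du dv) ->
    sprod (surface_velocity u v m du dv) (surface_velocity u v m 1 0) = du).
  { intros hp; rewrite sprod_non_isotropic_l, surface_velocity_form by apply hp; ring. }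
  split.
  - intros (hp & _ & _ & ht & h).
    rewrite hpq, hqn, pnorm_surface_velocity, Rmult_1_r in h by exact hp.
    apply space_like_iff in hp; rewrite surface_velocity_form in hp.
    apply sqrt_mult_eq_Rabs_iff in h; [ | exact hc | lra].
    split; [exact ht | split].
    + intros ->; generalize (Rle_0_sqr (u * dv)); unfold Rsqr; lra.
    + specialize (hcs' du); lra.
  - intros (ht & hdu & h).
    assert (hs := sinh_pos theta ht).
    assert (hd : du * du = (du * du - u * dv * (u * dv)) * (cosh theta * cosh theta)).
    { specialize (hcs' du); lra. }
    (* By [hd], this quantity times the square of [cosh theta] is [du * du], which is positive. *)
    assert (hd0 : 0 < du * du - u * dv * (u * dv)).
    { apply (Rmult_lt_reg_r (cosh theta * cosh theta)).
      - now apply Rmult_lt_0_compat.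
      - rewrite <- hd, Rmult_0_l; exact (Rsqr_pos_lt du hdu). }
    assert (hp : space_like (surface_velocity u v m du dv)).
    { apply space_like_iff; now rewrite surface_velocity_form. }
    split; [exact hp | split; [exact hq | split; [ | split; [exact ht | ]]]].
    (* If [u * dv] vanished, so would [du * sinh theta], although both factors are nonzero. *)
    + apply time_like_tangent_plane; intros h0; rewrite h0, !Rmult_0_l in h.
      symmetry in h; apply Rmult_integral in h.
      assert (du * sinh theta = 0) as h1 by tauto.
      apply Rmult_integral in h1; destruct h1; lra.
    + rewrite hpq, hqn, pnorm_surface_velocity, Rmult_1_r by exact hp.
      apply sqrt_mult_eq_Rabs_iff; [exact hc | lra | exact hd].
Qed.

(** As the meridian velocity has norm 1, the angle equation itself reads: |du| is the speed times
    [cosh theta]. *)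
Lemma pnorm_of_is_angle (u v m du dv theta : R) :
  is_angle (surface_velocity u v m du dv) (surface_velocity u v m 1 0) theta ->
  pnorm (surface_velocity u v m du dv) = Rabs du / cosh theta.
Proof.
  intros (hp & hq & _ & _ & h); assert (hc := cosh_pos theta).
  rewrite (pnorm_surface_velocity u v m 1 0 hq) in h.
  rewrite sprod_non_isotropic_l, surface_velocity_form in h by apply hp.
  replace (1 * 1 - u * 0 * (u * 0)) with 1 in h by ring.
  replace (du * 1 - u * dv * (u * 0)) with du in h by ring.
  rewrite h, sqrt_1; field; lra.
Qed.

(** * Resolving signs *)

(** Equal squares leave [x = e * y] or [x = - (e * y)]; in the second case [e * (x * y)] would be
    minus a square. *)
Lemma Rsqr_eq_same_sign (e x y : R) :
  is_sign e -> x * x = y * y -> 0 < e * (x * y) -> x = e * y.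
Proof.
  intros he h hxy.
  assert (h0 : (x - e * y) * (x + e * y) = 0).
  { transitivity (x * x - e * e * (y * y)); [ring | rewrite (is_sign_sqr _ he); lra]. }
  apply Rmult_integral in h0; destruct h0 as [h0 | h0]; [lra | ].
  assert (hx : x = - (e * y)) by lra.
  generalize (Rle_0_sqr (e * y)); unfold Rsqr.
  replace (e * (x * y)) with (- (e * y * (e * y))) in hxy by (rewrite hx; ring); lra.
Qed.

Lemma Rabs_mult_sign (e x : R) : is_sign e -> Rabs (e * x) = Rabs x.
Proof.
  intros [-> | ->]; [f_equal; ring | rewrite <- Rabs_Ropp; f_equal; ring].
Qed.

(** * The curves [gamma1] are loxodromes *)

(** Here u v' is the constant [e1 * e2 * sinh theta] and u' is [e1 * cosh theta], so u v' cosh theta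
    and u' sinh theta agree up to the factor [e2], as the angle criterion requires. *)
Lemma space_like_loxodrome_gamma1 (f : R -> R) (theta : R) (a b : Rbar) (e1 e2 : R) :
  smooth f -> 0 < theta -> is_sign e1 -> is_sign e2 ->
  (forall t, in_interval a b t -> t <> 0) ->
  space_like_loxodrome f theta a b (gamma1 f theta e1 e2).
Proof.
  intros hf htheta he1 he2 hn0; assert (hc := cosh_pos theta).
  pose (u := fun t => e1 * t * cosh theta).
  pose (v := fun t => e2 * tanh theta * ln (Rabs t)).
  assert (hsu : smooth_on a b u).
  { intros n t _; apply ex_derive_n_scal_r, ex_derive_n_scal_l.
    apply (ex_derive_n_ext (fun x => x ^ 1)); [exact pow_1 | apply ex_derive_n_pow]. }
  assert (hsv : smooth_on a b v).
  { intros n t ht; apply ex_derive_n_scal_l, ex_derive_n_ln_Rabs, hn0, ht. }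
  assert (hdu : forall t, Derive u t = e1 * cosh theta).
  { intros t; apply is_derive_unique; unfold u; auto_derive; [exact I | ring]. }
  assert (hdv : forall t, in_interval a b t -> Derive v t = e2 * tanh theta * / t).
  { intros t ht; apply is_derive_unique, is_derive_scal, is_derive_ln_Rabs, hn0, ht. }
  assert (hang : forall t, in_interval a b t ->
    is_angle (velocity (gamma1 f theta e1 e2) t) (velocity (meridian f (v t)) (u t)) theta).
  { intros t ht.
    rewrite velocity_meridian, (velocity_R1 f _ u v) by
      (solve [exact hf | exact (smooth_on_ex_derive a b u t hsu ht)
             | exact (smooth_on_ex_derive a b v t hsv ht)
             | apply filter_forall; reflexivity]).
    apply is_angle_surface_velocity_iff.
    rewrite hdu, hdv by exact ht.
    split; [exact htheta | split].
    - apply Rmult_integral_contrapositive_currified; [destruct he1 | ]; lra.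
    - assert (ht0 := hn0 t ht); unfold u, tanh.
      transitivity (e2 * e2 *
        (e1 * cosh theta * sinh theta * (e1 * cosh theta * sinh theta))).
      + field; split; [exact ht0 | lra].
      + rewrite (is_sign_sqr _ he2); ring. }
  exists u, v; split; [exact hsu | split; [exact hsv | ]].
  split; [reflexivity | split; [ | exact hang]].
  intros t ht; apply (hang t ht).
Qed.

(** * Integration of the loxodrome equation *)

Lemma loxodrome_eq_rotated_gamma1 (f : R -> R) (theta : R) (a b : Rbar)
    (gamma : R -> vec3) :
  smooth f -> Rbar_lt a b -> space_like_loxodrome f theta a b gamma ->
  exists (e1 e2 v0 : R) (phi : R -> R),
    is_sign e1 /\ is_sign e2 /\
    arc_length_parameter a b gamma phi /\
    (forall t, in_interval a b t ->
       phi t <> 0 /\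
       gamma t = hyp_rotation v0 (gamma1 f theta e1 e2 (phi t))).
Proof.
  intros hf hab (u & v & hsu & hsv & hg & _ & hang).
  assert (hc := cosh_pos theta).
  assert (hu := fun t => smooth_on_ex_derive a b u t hsu).
  assert (hv := fun t => smooth_on_ex_derive a b v t hsv).
  assert (hvel : forall t, in_interval a b t -> velocity gamma t =
    surface_velocity (u t) (v t) (Derive f (u t)) (Derive u t) (Derive v t)).
  { intros t ht; apply velocity_R1; auto.
    generalize (in_interval_locally a b t ht); apply filter_imp; exact hg. }
  assert (hang' : forall t, in_interval a b t -> is_angle
    (surface_velocity (u t) (v t) (Derive f (u t)) (Derive u t) (Derive v t))
    (surface_velocity (u t) (v t) (Derive f (u t)) 1 0) theta).
  { intros t ht; rewrite <- hvel, <- velocity_meridian by assumption; exact (hang t ht). }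
  assert (hspeed : forall t, in_interval a b t ->
    pnorm (velocity gamma t) = Rabs (Derive u t) / cosh theta).
  { intros t ht; rewrite hvel by exact ht; apply pnorm_of_is_angle, hang', ht. }
  assert (hode : forall t, in_interval a b t -> 0 < theta /\ Derive u t <> 0 /\
    u t * Derive v t * cosh theta * (u t * Derive v t * cosh theta) =
    Derive u t * sinh theta * (Derive u t * sinh theta)).
  { intros t ht; exact (proj1 (is_angle_surface_velocity_iff _ _ _ _ _ _) (hang' t ht)). }
  clear hang hang' hvel.
  assert (hdu0 : forall t, in_interval a b t -> Derive u t <> 0) by (intros t ht; apply (hode t ht)).
  (* A zero of u v' would force u' sinh theta = 0. *)
  assert (huv0 : forall t, in_interval a b t -> u t * Derive v t <> 0).
  { intros t ht h0; destruct (hode t ht) as (ht0 & hdu & h).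
    assert (hs := sinh_pos theta ht0).
    rewrite h0, !Rmult_0_l in h.
    assert (du_s : Derive u t * sinh theta <> 0)
      by (apply Rmult_integral_contrapositive_currified; lra).
    generalize (Rsqr_pos_lt _ du_s); unfold Rsqr; lra. }
  assert (hu0 : forall t, in_interval a b t -> u t <> 0).
  { intros t ht h0; apply (huv0 t ht); rewrite h0; ring. }
  destruct (constant_sign a b (Derive u)) as (e1 & he1 & hs1); trivial.
  { intros t ht; exact (smooth_on_ex_derive_Derive a b u t hsu ht). }
  (* The equation between squares leaves one sign open at each point. It is the sign of u v' u',
     which is continuous without zeros, so a single [e2] serves the whole interval. *)
  destruct (constant_sign a b (fun t => u t * Derive v t * Derive u t))
    as (e2 & he2 & hs2); trivial.
  { intros t ht.
    assert (h1 := smooth_on_ex_derive_Derive a b u t hsu ht).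
    assert (h2 := smooth_on_ex_derive_Derive a b v t hsv ht).
    assert (h3 := hu t ht).
    exact (ex_derive_mult _ _ t (ex_derive_mult _ _ t h3 h2) h1). }
  { intros t ht; apply Rmult_integral_contrapositive_currified; auto. }
  assert (hdv : forall t, in_interval a b t ->
    u t * Derive v t * cosh theta = e2 * (Derive u t * sinh theta)).
  { intros t ht; destruct (hode t ht) as (ht0 & _ & h).
    apply Rsqr_eq_same_sign; trivial.
    replace (e2 * _) with
      (e2 * (u t * Derive v t * Derive u t) * (cosh theta * sinh theta)) by ring.
    apply Rmult_lt_0_compat; [exact (hs2 t ht) | ].
    apply Rmult_lt_0_compat; [exact hc | exact (sinh_pos theta ht0)]. }
  (* The speed |u'| / cosh theta equals e1 u' / cosh theta, and [phi] is a primitive of it. Its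
     additive constant is the one for which [e1 * phi t * cosh theta = u t]. *)
  pose (phi := fun t => e1 / cosh theta * u t).
  assert (hphi0 : forall t, in_interval a b t -> phi t <> 0).
  { intros t ht; unfold phi; apply Rmult_integral_contrapositive_currified; [ | auto].
    apply Rmult_integral_contrapositive_currified;
      [destruct he1; lra | apply Rinv_neq_0_compat; lra]. }
  assert (hdphi : forall t, in_interval a b t ->
    is_derive phi t (e1 / cosh theta * Derive u t)).
  { intros t ht; apply is_derive_scal, Derive_correct, hu, ht. }
  (* The deviation of [v] from the angle in [gamma1]; it is constant, and its value is the rotation
     angle [v0]. *)
  pose (w := fun t => v t - e2 * tanh theta * ln (Rabs (phi t))).
  assert (hw : forall t, in_interval a b t -> is_derive w t 0).
  { intros t ht.
    assert (hln := is_derive_comp _ phi t _ _ (is_derive_ln_Rabs (phi t) (hphi0 t ht))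
                     (hdphi t ht)).
    assert (hd := is_derive_minus _ _ t _ _ (Derive_correct v t (hv t ht))
                    (is_derive_scal _ t (e2 * tanh theta) _ hln)).
    replace 0 with (minus (Derive v t) (e2 * tanh theta *
      scal (e1 / cosh theta * Derive u t) (/ phi t))); [exact hd | ].
    unfold minus, plus, opp, scal; simpl; unfold mult; simpl.
    assert (he10 : e1 <> 0) by (destruct he1; lra).
    assert (hut := hu0 t ht).
    (* Since phi' / phi = u' / u, the derivative of [w] is v' - e2 tanh theta u' / u, whose
       numerator over the common denominator vanishes by [hdv]. *)
    transitivity ((u t * Derive v t * cosh theta - e2 * (Derive u t * sinh theta)) /
                  (u t * cosh theta)).
    - unfold phi, tanh; field; repeat split; auto; lra.
    - rewrite (hdv t ht); field; split; [lra | exact hut]. }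
  destruct (in_interval_inhabited a b hab) as [t0 ht0].
  exists e1, e2, (w t0), phi.
  split; [exact he1 | split; [exact he2 | split; [split | ]]].
  - intros n t ht; apply ex_derive_n_scal_l, hsu, ht.
  - intros t ht; rewrite hspeed by exact ht.
    rewrite (is_derive_unique _ _ _ (hdphi t ht)).
    rewrite <- (Rabs_mult_sign e1), Rabs_pos_eq by (try apply Rlt_le; auto).
    field; lra.
  - intros t ht; split; [exact (hphi0 t ht) | rewrite hg by exact ht].
    assert (hut : e1 * phi t * cosh theta = u t).
    { unfold phi; transitivity (e1 * e1 * u t); [field; lra | ].
      rewrite (is_sign_sqr _ he1); ring. }
    assert (hvt : v t = e2 * tanh theta * ln (Rabs (phi t)) + w t0).
    { rewrite <- (constant_of_is_derive_0 a b w t0 t) by assumption; unfold w; ring. }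
    unfold Defs.R1, hyp_rotation, gamma1, crd1, crd2, crd3; simpl.
    (* The addition formulas turn the shift of the angle by [w t0] into the hyperbolic rotation. *)
    rewrite hut, hvt, cosh_plus, sinh_plus.
    f_equal; f_equal; ring.
Qed.

Theorem theorem3p1 (f : R -> R) (hf : smooth f) (theta : R) (htheta : 0 < theta)
    (a b : Rbar) (hab : Rbar_lt a b) :
  (forall e1 e2 : R, is_sign e1 -> is_sign e2 ->
     (forall t, in_interval a b t -> t <> 0) ->
     space_like_loxodrome f theta a b (gamma1 f theta e1 e2)) /\
  (forall gamma : R -> vec3, space_like_loxodrome f theta a b gamma ->
     exists (e1 e2 v0 : R) (phi : R -> R),
       is_sign e1 /\ is_sign e2 /\
       arc_length_parameter a b gamma phi /\
       (forall t, in_interval a b t ->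
          phi t <> 0 /\
          gamma t = hyp_rotation v0 (gamma1 f theta e1 e2 (phi t)))).
Proof.
  split.
  - intros e1 e2 he1 he2 hn0; now apply space_like_loxodrome_gamma1.
  - intros gamma hg; now apply loxodrome_eq_rotated_gamma1.
Qed.
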